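(* Let $m,n\ge 2$. For every unitarily invariant norm $\|\cdot\|$ on $\mathbb{M}_n$ and all $A_1,\dots,A_m\in\mathbb{M}_n$, $$\Bigl\| \Bigl|\sum_{k=1}^m A_k\Bigr|_{\mathrm{qsym}} \Bigr\|\ \le\ \sqrt{\min\{m,2n\}}\,\Bigl\| \sum_{k=1}^m |A_k|_{\mathrm{qsym}} \Bigr\|.$$
   Context: $\mathbb{M}_n$ is the set of $n\times n$ complex matrices, $Z^*$ is the conjugate transpose of $Z$, $|Z|:=(Z^*Z)^{1/2}$, and the quadratic symmetric modulus is $|Z|_{\mathrm{qsym}}:=\left(\frac{|Z|^2+|Z^*|^2}{2}\right)^{1/2}$. A norm $\|\cdot\|$ on $\mathbb{M}_n$ is unitarily invariant if $\|UZV\|=\|Z\|$ for all $Z\in\mathbb{M}_n$ and all unitaries $U,V\in\mathbb{M}_n$. *)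

(* Defs.v *)
From HB Require Import structures.
From mathcomp Require Import all_boot all_order all_algebra.
From mathcomp Require Export reals complex.

Set Implicit Arguments.
Unset Strict Implicit.
Unset Printing Implicit Defensive.

Import Order.TTheory GRing.Theory Num.Theory.

Local Open Scope ring_scope.
Local Open Scope sesquilinear_scope.

Section MatrixModulus.
Variables (C : numClosedFieldType) (n : nat).
Implicit Types A B Z : 'M[C]_n.

(* [0 <= z] in C means that z is real and nonnegative. *)
Definition psdmx A : Prop :=
  A ^t* = A /\ forall v : 'rV[C]_n, 0 <= (v *m A *m v ^t*) 0 0.

(* A^(1/2), by the spectral decomposition; meaningful for positive
   semidefinite A, see [sqrtmx_psd], [sqrtmxK] and [sqrtmx_unique]. *)
Definition sqrtmx A : 'M[C]_n :=
  invmx (spectralmx A) *m diag_mx (map_mx sqrtC (spectral_diag A))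
    *m spectralmx A.

Definition absmx Z : 'M[C]_n := sqrtmx (Z ^t* *m Z).

Definition qsym Z : 'M[C]_n :=
  sqrtmx (2%:R^-1 *: (absmx Z *m absmx Z + absmx (Z ^t*) *m absmx (Z ^t*))).

Lemma trCmxK p q (M : 'M[C]_(p, q)) : (M ^t*) ^t* = M.
Proof. by apply/matrixP=> i j; rewrite !mxE conjCK. Qed.

Lemma trCmxM p q r (M : 'M[C]_(p, q)) (N : 'M[C]_(q, r)) :
  (M *m N) ^t* = N ^t* *m M ^t*.
Proof. by rewrite trmx_mul map_mxM. Qed.

Lemma psdmx_gram Z : psdmx (Z ^t* *m Z).
Proof.
split=> [|v]; first by rewrite trCmxM trCmxK.
rewrite mulmxA -mulmxA -[Z in X in _ *m X]trCmxK -trCmxM mxE.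
by apply: sumr_ge0 => i _; rewrite !mxE mul_conjC_ge0.
Qed.

Lemma psdmxD A B : psdmx A -> psdmx B -> psdmx (A + B).
Proof.
move=> [hA pA] [hB pB]; split=> [|v]; first by rewrite linearD map_mxD hA hB.
by rewrite mulmxDr mulmxDl mxE addr_ge0.
Qed.

Lemma psdmxZ a A : 0 <= a -> psdmx A -> psdmx (a *: A).
Proof.
move=> a0 [hA pA]; split=> [|v].
  by rewrite linearZ map_mxZ hA; congr (_ *: _); apply/CrealP/ger0_real.
by rewrite -scalemxAr -scalemxAl mxE mulr_ge0.
Qed.

Lemma psdmx_spectral A : psdmx A ->
  A = invmx (spectralmx A) *m diag_mx (spectral_diag A) *m spectralmx A.
Proof. by move=> [hA _]; apply/orthomx_spectralP; rewrite qualifE/= hA. Qed.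

Lemma psdmx_spectral_ge0 A i : psdmx A -> 0 <= spectral_diag A 0 i.
Proof.
move=> Apsd; have PU := spectral_unitarymx A; have Pu := spectral_unit A.
have := Apsd.2 (row i (spectralmx A)).
suff -> : (row i (spectralmx A) *m A *m (row i (spectralmx A)) ^t*) 0 0
    = spectral_diag A 0 i by [].
transitivity ((spectralmx A *m A *m (spectralmx A) ^t*) i i).
  rewrite -row_mul [LHS]mxE [RHS]mxE; apply: eq_bigr => j _.
  by rewrite ![in LHS]mxE ![in RHS]mxE.
rewrite -invmx_unitary // [X in _ *m X *m _](psdmx_spectral Apsd).
by rewrite !mulmxA mulmxK // mulmxV // mul1mx mxE eqxx mulr1n.
Qed.

Lemma psdmx_unitary_diag (P : 'M[C]_n) (d : 'rV[C]_n) : P \is unitarymx ->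
  (forall i, 0 <= d 0 i) -> psdmx (invmx P *m diag_mx d *m P).
Proof.
move=> PU d0; pose s := diag_mx (map_mx sqrtC d).
have -> : invmx P *m diag_mx d *m P = (s *m P) ^t* *m (s *m P).
  rewrite trCmxM -invmx_unitary // !mulmxA; congr (_ *m _).
  rewrite -!mulmxA; congr (_ *m _); apply/matrixP=> i j.
  rewrite [s ^t* *m s]mul_mx_diag !mxE eq_sym.
  case: eqVneq => [->|_]; last by rewrite mulr0n conjC0 mul0r.
  rewrite !mulr1n (CrealP _) -?expr2 ?sqrtCK //.
  by rewrite ger0_real // sqrtC_ge0.
exact: psdmx_gram.
Qed.

Lemma sqrtmx_psd A : psdmx A -> psdmx (sqrtmx A).
Proof.
move=> Apsd; apply: psdmx_unitary_diag; first exact: spectral_unitarymx.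
by move=> i; rewrite mxE sqrtC_ge0 psdmx_spectral_ge0.
Qed.

Lemma sqrtmxK A : psdmx A -> sqrtmx A *m sqrtmx A = A.
Proof.
move=> Apsd; rewrite [RHS](psdmx_spectral Apsd) /sqrtmx !mulmxA.
congr (_ *m _); rewrite mulmxK ?spectral_unit // -mulmxA; congr (_ *m _).
apply/matrixP=> i j; rewrite mul_mx_diag !mxE.
case: eqVneq => [->|_]; last by rewrite !mulr0n mul0r.
by rewrite !mulr1n -expr2 sqrtCK.
Qed.

Lemma sqrtmx_unique A B : psdmx B -> B *m B = A -> B = sqrtmx A.
Proof.
move=> Bpsd BA; have Apsd : psdmx A by rewrite -BA -{1}Bpsd.1; apply: psdmx_gram.
have Spsd := sqrtmx_psd Apsd.
have : sqrtmx A *m sqrtmx A = B *m B by rewrite sqrtmxK.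
move: (sqrtmx A) Spsd => S Spsd SB.
have Pu := spectral_unit B; have Qu := spectral_unit S.
have d0 i := psdmx_spectral_ge0 i Bpsd; have e0 i := psdmx_spectral_ge0 i Spsd.
move: (psdmx_spectral Bpsd) (psdmx_spectral Spsd) SB Pu Qu d0 e0.
move: (spectralmx B) (spectralmx S) (spectral_diag B) (spectral_diag S).
move=> P Q d e -> -> SB Pu Qu d0 e0.
have comm (U : 'M[C]_n) :
    diag_mx e *m (diag_mx e *m U) = U *m diag_mx d *m diag_mx d ->
  diag_mx e *m U = U *m diag_mx d.
  move=> U2; apply/matrixP=> i j; move/matrixP/(_ i j): U2.
  rewrite !mul_mx_diag !mul_diag_mx !mxE => /eqP.
  have [->|U0] := eqVneq (U i j) 0; first by rewrite mulr0 mul0r.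
  rewrite mulrA [_ * U i j]mulrC -[X in _ == X]mulrA (inj_eq (mulfI U0)) -!expr2.
  by rewrite eqrXn2 // => /eqP ->; rewrite mulrC.
have : diag_mx e *m (Q *m invmx P) = Q *m invmx P *m diag_mx d.
  apply: comm; move/(congr1 (fun X => Q *m X *m invmx P)): SB.
  by rewrite !mulmxA !mulmxK // mulmxV // mul1mx.
move/(congr1 (fun X => invmx Q *m X *m P)).
by rewrite !mulmxA mulVmx // mul1mx mulmxKV.
Qed.

End MatrixModulus.

(* A norm on the complex vector space 'M[R[i]]_n; the modulus of a complex
   scalar is itself an element of R[i], whence the embedding of R in R[i]. *)
Definition is_norm (R : realType) (n : nat) (N : 'M[R[i]]_n -> R) : Prop :=
  [/\ forall Z, N Z = 0 -> Z = 0,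
      forall (a : R[i]) Z, (N (a *: Z))%:C%C = `|a| * (N Z)%:C%C
    & forall Y Z, N (Y + Z) <= N Y + N Z].

Definition unitarily_invariant (R : realType) (n : nat)
    (N : 'M[R[i]]_n -> R) : Prop :=
  forall Z U V : 'M[R[i]]_n, U \is unitarymx -> V \is unitarymx ->
    N (U *m Z *m V) = N Z.

(* Main.v *)
Require Import Defs.
From mathcomp Require Import all_boot all_order all_algebra.

(** Stacking [Z] over its adjoint and dividing by the square root of two gives
    a matrix [T] of size 2n x n with [T^H T] equal to half of
    [|Z|^2 + |Z^H|^2], where [^H] denotes the adjoint. So the quadratic
    symmetric modulus of [Z] is the ordinary modulus of [T], and [T] depends
    additively on [Z]. It is therefore enough to bound the modulus of a sum of
    rectangular matrices [T_k] with [n] columns ([uinorm_modulus_sum_le]); the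
    constant obtained there is the square root of [min(m, n)], which is at
    most that of [min(m, 2n)].

    Let now [T] be the sum of the [T_k]. By polar decomposition [T_k = U_k q_k]
    with [q_k = |T_k|], and [L = |T| = V^H T] for a partial isometry [V]. Hence
    [L] is the sum of the [K_k q_k], where the square matrices [K_k = V^H U_k]
    are contractions. As [L] is Hermitian, for real [c > 0]

      [0 <= \sum_k (K_k - c) q_k (K_k - c)^H = P - 2 c L + c^2 S],

    with [P = \sum_k K_k q_k K_k^H] and [S = \sum_k q_k]. A unitarily invariant
    norm is monotone on positive semidefinite matrices, so
    [2 c N(L) <= N(P) + c^2 N(S)]. If [N(P) <= c^2 N(S)], then
    [N(L) <= c N(S)]. It remains to take [c^2 = min(m, n)]
    ([uinorm_sum_conj_le]):

    - [N(P) <= m N(S)], because each [N(K_k q_k K_k^H)] is at most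
      [N(q_k) <= N(S)];
    - [N(P) <= n N(S)], because [N(X) <= tr(X) N(E) <= n N(X)] for every
      positive semidefinite [X], where [E] is a diagonal matrix unit, and
      [tr(P) <= tr(S)].

    Three properties of unitarily invariant norms carry this argument:
    pinching to the diagonal ([uinorm_pinching]), monotonicity
    ([uinorm_psd_le]), and the equality of the norms of [X X^H] and [X^H X]
    ([uinorm_gramC]). *)

Set Implicit Arguments.
Unset Strict Implicit.
Unset Printing Implicit Defensive.

Import Order.TTheory GRing.Theory Num.Theory.

Local Open Scope ring_scope.
Local Open Scope sesquilinear_scope.

(** * Adjoints, Gram matrices and the positive semidefinite order *)

Section Adjoint.
Variable C : numClosedFieldType.

Lemma adjmxD p q (A B : 'M[C]_(p, q)) : (A + B) ^t* = A ^t* + B ^t*.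
Proof. by rewrite linearD map_mxD. Qed.

Lemma adjmxB p q (A B : 'M[C]_(p, q)) : (A - B) ^t* = A ^t* - B ^t*.
Proof. by rewrite linearB map_mxB. Qed.

Lemma adjmxZ p q (a : C) (A : 'M[C]_(p, q)) : (a *: A) ^t* = a^* *: A ^t*.
Proof. by rewrite linearZ map_mxZ. Qed.

Lemma adjmx_sum p q I (r : seq I) (A : I -> 'M[C]_(p, q)) :
  (\sum_(i <- r) A i) ^t* = \sum_(i <- r) (A i) ^t*.
Proof. by rewrite linear_sum map_mx_sum. Qed.

Lemma adjmx1 n : (1%:M : 'M[C]_n) ^t* = 1%:M.
Proof. by rewrite trmx1 map_mx1. Qed.

Lemma gram_diagE p q (X : 'M[C]_(p, q)) i :
  (X ^t* *m X) i i = \sum_j X j i * (X j i)^*.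
Proof. by rewrite mxE; apply: eq_bigr => j _; rewrite !mxE mulrC. Qed.

Lemma gram_eq0 p q (X : 'M[C]_(p, q)) : X ^t* *m X = 0 -> X = 0.
Proof.
move=> X0; apply/matrixP=> j i; rewrite mxE.
have := gram_diagE X i; rewrite X0 mxE => /esym/eqP.
rewrite psumr_eq0 => [|k _]; last exact: mul_conjC_ge0.
by move=> /allP/(_ j); rewrite mem_index_enum mul_conjC_eq0 => /(_ isT)/eqP.
Qed.

Lemma psdmx_gramr p n (X : 'M[C]_(p, n)) : psdmx (X ^t* *m X).
Proof.
split=> [|v]; first by rewrite trCmxM trCmxK.
rewrite mulmxA -mulmxA -[X in X in _ *m X]trCmxK -trCmxM mxE.
by apply: sumr_ge0 => i _; rewrite !mxE mul_conjC_ge0.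
Qed.

Lemma psdmx0 n : psdmx (0 : 'M[C]_n).
Proof. by have := psdmx_gramr (0 : 'M[C]_n); rewrite mulmx0. Qed.

Lemma psdmx_sum n I (r : seq I) (P : pred I) (A : I -> 'M[C]_n) :
  (forall i, psdmx (A i)) -> psdmx (\sum_(i <- r | P i) A i).
Proof.
move=> A_psd; elim/big_ind: _ => //; [exact: psdmx0 | exact: psdmxD].
Qed.

Lemma psdmx_conj p n (A : 'M[C]_p) (X : 'M[C]_(p, n)) :
  psdmx A -> psdmx (X ^t* *m A *m X).
Proof.
move=> Apsd; have [Rh _] := sqrtmx_psd Apsd.
rewrite -(sqrtmxK Apsd) -{1}Rh mulmxA -trCmxM -mulmxA.
exact: psdmx_gramr.
Qed.

Lemma psdmx_diag_ge0 n (A : 'M[C]_n) i : psdmx A -> 0 <= A i i.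
Proof.
move=> Apsd; have [Rh _] := sqrtmx_psd Apsd.
rewrite -(sqrtmxK Apsd) -{1}Rh gram_diagE.
by apply: sumr_ge0 => j _; apply: mul_conjC_ge0.
Qed.

Lemma psdmx_trace_le n (A B : 'M[C]_n) : psdmx (B - A) -> \tr A <= \tr B.
Proof.
move=> BA; rewrite -subr_ge0 -linearB /=.
by apply: sumr_ge0 => i _; apply: psdmx_diag_ge0.
Qed.

Lemma psdmx_trace_spectral n (A : 'M[C]_n) :
  psdmx A -> \tr A = \sum_i spectral_diag A 0 i.
Proof.
move=> Apsd; rewrite {1}(psdmx_spectral Apsd) mxtrace_mulC mulmxA.
by rewrite mulmxV ?spectral_unit // mul1mx mxtrace_diag.
Qed.

(** * Polar decomposition and contractions *)

(** The partial isometry is [V = T F], where [F] is the Moore-Penrose inverse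
    of [S = |T|], obtained by inverting the eigenvalues of [S]. The convention
    [0^-1 = 0] handles the kernel: there [F S] is only a projection, but
    [T F S = T] still holds, since [T] vanishes wherever [S] does. *)
Theorem polar_decomposition p n (T : 'M[C]_(p, n)) :
  exists V : 'M[C]_(p, n),
    [/\ V *m sqrtmx (T ^t* *m T) = T, V ^t* *m T = sqrtmx (T ^t* *m T)
      & V *m V ^t* *m V = V].
Proof.
set G := T ^t* *m T; have Gpsd : psdmx G by apply: psdmx_gramr.
have [Sh _] := sqrtmx_psd Gpsd; have SS := sqrtmxK Gpsd.
set S := sqrtmx G in Sh SS *.
pose P := spectralmx G; pose s := map_mx sqrtC (spectral_diag G).
pose F := invmx P *m diag_mx (map_mx GRing.inv s) *m P.
have Pu : P \in unitmx := spectral_unit G.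
have mulD (d e : 'rV[C]_n) :
    invmx P *m diag_mx d *m P *m (invmx P *m diag_mx e *m P) =
    invmx P *m diag_mx (\row_i (d 0 i * e 0 i)) *m P.
  rewrite !mulmxA mulmxK // -[_ *m diag_mx d *m _]mulmxA mulmx_diag.
  by congr (_ *m diag_mx _ *m _); apply/rowP=> i; rewrite !mxE.
have SE : S = invmx P *m diag_mx s *m P by [].
have s_ge0 i : 0 <= s 0 i by rewrite mxE sqrtC_ge0 psdmx_spectral_ge0.
have Fh : F ^t* = F.
  have [] // : psdmx F.
  apply: psdmx_unitary_diag; first exact: spectral_unitarymx.
  by move=> i; rewrite mxE invr_ge0.
have invE i : (s 0 i)^-1 * s 0 i * (s 0 i)^-1 = (s 0 i)^-1.
  have [->|s0] := eqVneq (s 0 i) 0; first by rewrite invr0 mulr0.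
  by rewrite mulVf // mul1r.
have sE i : s 0 i * (s 0 i)^-1 * s 0 i = s 0 i.
  have [->|s0] := eqVneq (s 0 i) 0; first by rewrite mulr0.
  by rewrite mulfV // mul1r.
have FSC : F *m S = S *m F.
  rewrite /F SE !mulD; congr (_ *m diag_mx _ *m _).
  by apply/rowP=> i; rewrite !mxE mulrC.
have FSF : F *m S *m F = F.
  rewrite /F SE !mulD; congr (_ *m diag_mx _ *m _).
  by apply/rowP=> i; rewrite ![in LHS]mxE [RHS]mxE -[RHS]invE !mxE.
have SFS : S *m F *m S = S.
  rewrite /F SE !mulD; congr (_ *m diag_mx _ *m _).
  by apply/rowP=> i; rewrite ![in LHS]mxE -[RHS]sE !mxE.
clearbody F S; clear SE.
have VT : (T *m F) ^t* *m T = S.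
  by rewrite trCmxM Fh -mulmxA -/G -SS mulmxA FSC SFS.
(* The Gram matrix of [T F S - T] vanishes because [S F S = S]. *)
have TFS : T *m F *m S = T.
  apply/eqP; rewrite -subr_eq0; apply/eqP/gram_eq0.
  have -> : T *m F *m S - T = T *m (F *m S - 1%:M).
    by rewrite mulmxBr mulmx1 mulmxA.
  rewrite trCmxM -mulmxA [X in _ *m X]mulmxA -/G -SS mulmxBr mulmx1.
  have -> : S *m S *m (F *m S) = S *m S.
    by rewrite -mulmxA [S *m (F *m S)]mulmxA SFS.
  by rewrite subrr mulmx0.
exists (T *m F); split=> //.
by rewrite mulmxA -[_ *m T]mulmxA VT TFS.
Qed.

Definition contraction p q (K : 'M[C]_(p, q)) := psdmx (1%:M - K ^t* *m K).

(** [V^H V] is an orthogonal projection, hence so is [1 - V^H V], which is thus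
    its own Gram matrix. *)
Lemma partial_isometry_contraction p q (V : 'M[C]_(p, q)) :
  V *m V ^t* *m V = V -> contraction V.
Proof.
move=> VVV; rewrite /contraction.
have VV : V ^t* *m V *m (V ^t* *m V) = V ^t* *m V.
  by rewrite -mulmxA [V *m _]mulmxA VVV.
have Eh : (1%:M - V ^t* *m V) ^t* = 1%:M - V ^t* *m V.
  by rewrite adjmxB adjmx1 trCmxM trCmxK.
have := psdmx_gramr (1%:M - V ^t* *m V); rewrite Eh.
by rewrite mulmxBr mulmx1 mulmxBl mul1mx VV subrr subr0.
Qed.

Lemma contractionM p q r (K : 'M[C]_(p, q)) (M : 'M[C]_(q, r)) :
  contraction K -> contraction M -> contraction (K *m M).
Proof.
move=> cK cM; rewrite /contraction trCmxM.
have -> : 1%:M - M ^t* *m K ^t* *m (K *m M) =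
    (1%:M - M ^t* *m M) + M ^t* *m (1%:M - K ^t* *m K) *m M.
  by rewrite mulmxBr mulmx1 mulmxBl addrA subrK !mulmxA.
by apply: psdmxD => //; apply: psdmx_conj.
Qed.

End Adjoint.

(** * Pinching and monotonicity *)

Lemma half_double (C : numClosedFieldType) (x : C) : 2^-1 * (x + x) = x.
Proof. by rewrite -mulr2n -[x *+ 2]mulr_natl mulKf ?pnatr_eq0. Qed.

Section UnitarilyInvariantSeminorm.
(** The norm takes its values in [C] itself, so that eigenvalues, traces and
    norms can be compared without coercions. *)
Variables (C : numClosedFieldType) (n : nat) (N : 'M[C]_n -> C).
Hypothesis NZ : forall a Z, N (a *: Z) = `|a| * N Z.
Hypothesis ND : forall Y Z, N (Y + Z) <= N Y + N Z.
Hypothesis NU : forall Z U V : 'M[C]_n,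
  U \is unitarymx -> V \is unitarymx -> N (U *m Z *m V) = N Z.

Lemma uinorm0 : N 0 = 0.
Proof. by rewrite -(scale0r 0) NZ normr0 mul0r. Qed.

Lemma uinorm_ge0 Z : 0 <= N Z.
Proof.
have := ND Z (- 1 *: Z); rewrite NZ normrN1 mul1r scaleN1r subrr uinorm0.
by rewrite -mulr2n pmulrn_lge0.
Qed.

Lemma uinormZ a Z : 0 <= a -> N (a *: Z) = a * N Z.
Proof. by move=> a0; rewrite NZ ger0_norm. Qed.

Lemma uinorm_sum I (r : seq I) (A : I -> 'M[C]_n) :
  N (\sum_(i <- r) A i) <= \sum_(i <- r) N (A i).
Proof.
elim: r => [|i r IHr]; first by rewrite !big_nil uinorm0.
by rewrite !big_cons (le_trans (ND _ _)) // lerD2l.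
Qed.

Let unitary1 : (1%:M : 'M[C]_n) \is unitarymx.
Proof. by apply/unitarymxP; rewrite adjmx1 mulmx1. Qed.

Lemma uinormUl U Z : U \is unitarymx -> N (U *m Z) = N Z.
Proof. by move=> UU; rewrite -[U *m Z]mulmx1 NU. Qed.

Lemma uinorm_spectral A : psdmx A -> N A = N (diag_mx (spectral_diag A)).
Proof.
move=> Apsd; have PU := spectral_unitarymx A.
by rewrite [in LHS](psdmx_spectral Apsd) invmx_unitary // NU // trmxC_unitary.
Qed.

Lemma diag_mx_unitary (w : 'rV[C]_n) :
  (forall i, w 0 i * (w 0 i)^* = 1) -> diag_mx w \is unitarymx.
Proof.
move=> w1; apply/unitarymxP/matrixP=> i j; rewrite mul_diag_mx !mxE eq_sym.
by case: eqVneq => [->|_]; rewrite ?mulr1n ?w1 // mulr0n conjC0 mulr0.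
Qed.

(** A number [d] of [[0, 1]] is the midpoint of the numbers
    [d + i sqrt (1 - d^2)] and [d - i sqrt (1 - d^2)] of modulus one, so
    [diag_mx d] is the average of two diagonal unitaries. *)
Lemma uinorm_diagM_le (d : 'rV[C]_n) Z :
  (forall i, 0 <= d 0 i <= 1) -> N (diag_mx d *m Z) <= N Z.
Proof.
move=> d01; pose w := \row_i (d 0 i + 'i * sqrtC (1 - d 0 i ^+ 2)).
have realD i : (d 0 i)^* = d 0 i.
  by apply/CrealP/ger0_real; case/andP: (d01 i).
have realS i : (sqrtC (1 - d 0 i ^+ 2))^* = sqrtC (1 - d 0 i ^+ 2).
  apply/CrealP/ger0_real; rewrite sqrtC_ge0 subr_ge0.
  by case/andP: (d01 i) => d0 d1; rewrite expr_le1.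
have wC i : (w 0 i)^* = d 0 i - 'i * sqrtC (1 - d 0 i ^+ 2).
  by rewrite mxE rmorphD rmorphM /= conjCi realD realS mulNr.
have w1 i : w 0 i * (w 0 i)^* = 1.
  rewrite wC mxE [LHS]mulrC -subr_sqr exprMn sqrCi sqrtCK mulN1r opprK.
  by rewrite addrC subrK.
have -> : diag_mx d = 2^-1 *: (diag_mx w + diag_mx (map_mx (fun x => x^*) w)).
  apply/matrixP=> i j; rewrite !mxE -mulrnDl.
  have [->|_] := eqVneq i j; last by rewrite !mulr0n mulr0.
  have := wC j; rewrite mxE => ->.
  by rewrite !mulr1n addrACA subrr addr0 half_double.
rewrite -scalemxAl uinormZ ?invr_ge0 ?ler0n // mulmxDl.
rewrite ler_pdivrMl ?ltr0n // (le_trans (ND _ _)) // mulr_natl mulr2n.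
rewrite !uinormUl //; apply: diag_mx_unitary => i; rewrite ?w1 //.
by rewrite mxE conjCK mulrC w1.
Qed.

Lemma uinorm_diag_le (a b : 'rV[C]_n) :
  (forall i, 0 <= a 0 i <= b 0 i) -> N (diag_mx a) <= N (diag_mx b).
Proof.
move=> ab; have -> : diag_mx a = diag_mx (\row_i (a 0 i / b 0 i)) *m diag_mx b.
  rewrite mulmx_diag; congr diag_mx; apply/rowP=> i; rewrite !mxE.
  have [b0|b0] := eqVneq (b 0 i) 0; last by rewrite divfK.
  by apply/eqP; rewrite b0 mulr0 eq_le -{1}b0 andbC.
apply: uinorm_diagM_le => i; rewrite mxE; case/andP: (ab i) => a0 ale.
have [b0|b0] := eqVneq (b 0 i) 0; first by rewrite b0 invr0 mulr0 lexx ler01.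
have b_gt0 : 0 < b 0 i by rewrite lt_def b0 (le_trans a0).
by rewrite divr_ge0 ?(ltW b_gt0) //= ler_pdivrMr // mul1r.
Qed.

(** The average of [B] and of its conjugate by the diagonal unitary that flips
    the sign of the [i]-th coordinate has the same diagonal as [B], but
    zeros elsewhere in row [i] and column [i]. Doing this for all [i] leaves the
    diagonal of [B] alone, and no step increases the norm. *)
Lemma uinorm_pinching (B : 'M[C]_n) : N (diag_mx (\row_i B i i)) <= N B.
Proof.
(* [keep s j k]: the entry [(j, k)] survives the flips of the indices in [s]. *)
pose keep (s : seq 'I_n) j k := all (fun i => (j == i) == (k == i)) s.
have pinch s : N (\matrix_(j, k) (B j k *+ keep s j k)) <= N B.
  elim: s => [|i s IHs].
    rewrite le_eqVlt; apply/orP; left; apply/eqP; congr N.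
    by apply/matrixP=> j k; rewrite mxE.
  apply: le_trans IHs; set Bs := (X in _ <= N X).
  pose w := \row_j ((-1) ^+ (j == i) : C).
  have wU : diag_mx w \is unitarymx.
    apply: diag_mx_unitary => j; rewrite mxE rmorphXn rmorphN1 -expr2.
    by rewrite sqrr_sign.
  have -> : \matrix_(j, k) (B j k *+ keep (i :: s) j k) =
            2^-1 *: (Bs + diag_mx w *m Bs *m diag_mx w).
    apply/matrixP=> j k; rewrite mul_mx_diag mul_diag_mx !mxE /=.
    case: (j == i); case: (k == i);
      rewrite /= ?mulN1r ?mulrN1 ?mul1r ?mulr1 ?opprK ?subrr ?mulr0 //.
      by rewrite half_double.
    by rewrite half_double.
  rewrite uinormZ ?invr_ge0 ?ler0n // ler_pdivrMl ?ltr0n //.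
  by rewrite (le_trans (ND _ _)) // NU // mulr_natl mulr2n.
apply: le_trans (pinch (enum 'I_n)); rewrite le_eqVlt; apply/orP; left.
apply/eqP; congr N; apply/matrixP=> j k; rewrite !mxE.
case: eqVneq => [->|jk].
  by rewrite (_ : keep _ k k) //; apply/allP=> i _; rewrite eqxx.
rewrite (_ : keep _ j k = false) //; apply/negbTE/allPn; exists j.
  by rewrite mem_enum.
by rewrite eqxx [k == j]eq_sym (negbTE jk).
Qed.

(** In an orthonormal eigenbasis of [A] the diagonal of [B] dominates the
    eigenvalues of [A], so pinching [B] to that diagonal reduces the comparison
    to diagonal matrices. *)
Lemma uinorm_psd_le (A B : 'M[C]_n) :
  psdmx A -> psdmx (B - A) -> N A <= N B.
Proof.
move=> Apsd BA; have PU := spectral_unitarymx A.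
set P := spectralmx A in PU.
have -> : N B = N (P *m B *m P ^t*) by rewrite NU ?trmxC_unitary.
rewrite uinorm_spectral //; apply: le_trans (uinorm_pinching _).
apply: uinorm_diag_le => i; rewrite psdmx_spectral_ge0 //= mxE -subr_ge0.
have Ad : P *m A *m P ^t* = diag_mx (spectral_diag A).
  rewrite [X in _ *m X *m _](psdmx_spectral Apsd) -invmx_unitary // -/P !mulmxA.
  by rewrite mulmxV ?mul1mx ?mulmxK ?unitarymx_unit.
have := psdmx_diag_ge0 i (psdmx_conj (P ^t*) BA); rewrite trCmxK.
by rewrite mulmxBr mulmxBl Ad !mxE eqxx mulr1n.
Qed.

(** * The norms of the two Gram matrices of a square matrix *)

Lemma uinorm_gramC_unit (X : 'M[C]_n) : X \in unitmx ->
  N (X *m X ^t*) = N (X ^t* *m X).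
Proof.
move=> Xu; have [V [VS _ VVV]] := polar_decomposition X.
have XXpsd := psdmx_gramr X.
have [Sh _] := sqrtmx_psd XXpsd; have SS := sqrtmxK XXpsd.
move: (sqrtmx _) VS Sh SS => S VS Sh SS.
have Vu : V \in unitmx by move: Xu; rewrite -VS unitmx_mul => /andP[].
have VU : V \is unitarymx.
  by apply/unitarymxP; rewrite -[LHS](mulmxK Vu) VVV mulmxV.
transitivity (N (V *m (S *m S) *m V ^t*)); last first.
  by rewrite NU ?trmxC_unitary ?SS.
by rewrite -VS trCmxM Sh !mulmxA.
Qed.

(** The scalars [e] making [X + e] singular are the finitely many roots of
    the characteristic polynomial of [- X], so they cannot include all the
    [eta / k]. *)
Lemma exists_small_unit (X : 'M[C]_n) (eta : C) : 0 < eta ->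
  exists2 e, 0 < e <= eta & X + e%:M \in unitmx.
Proof.
move=> eta0; pose p := char_poly (- X).
pose es := [seq eta / (i.+1%:R : C) | i <- iota 0 (size p)].
have p0 : p != 0 by rewrite monic_neq0 // char_poly_monic.
have es_uniq : uniq es.
  rewrite map_inj_uniq ?iota_uniq // => i j /(mulfI (lt0r_neq0 eta0)).
  by move/invr_inj/eqP; rewrite eqr_nat eqSS => /eqP.
have := contraNN (fun rs => max_poly_roots p0 rs es_uniq).
rewrite size_map size_iota ltnn => /(_ isT) /allPn[_ /mapP[i _ ->]] pN0.
exists (eta / i.+1%:R).
  rewrite divr_gt0 ?ltr0n //= ler_pdivrMr ?ltr0n //.
  by rewrite ler_peMr ?(ltW eta0) // ler1n.
move: pN0; rewrite -eigenvalue_root_char /eigenvalue negbK /eigenspace.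
by rewrite kermx_eq0 row_free_unit -opprD -scaleN1r unitmxZ ?unitrN1.
Qed.

(** For invertible [X] the unitary polar factor conjugates one Gram matrix into
    the other. The general case follows by perturbation: replacing [X] by the
    invertible matrix [X + e] with small [e > 0] adds the same Hermitian
    matrix [D], of norm [O(e)], to both Gram matrices. Applied to [X] and to
    its adjoint, the inequality is an equality. *)
Lemma uinorm_gramC (X : 'M[C]_n) : N (X *m X ^t*) <= N (X ^t* *m X).
Proof.
pose M := N (X + X ^t*) + N 1%:M.
have M0 : 0 <= M by rewrite addr_ge0 ?uinorm_ge0.
have near e : 0 < e <= 1 -> X + e%:M \in unitmx ->
    N (X *m X ^t*) <= N (X ^t* *m X) + e * M *+ 2.
  move=> /andP[e0 e1] Xeu; have eC : e^* = e by apply/CrealP/gtr0_real.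
  pose D := e *: (X + X ^t* + e *: 1%:M).
  have ND_le : N D <= e * M.
    rewrite uinormZ ?(ltW e0) // ler_pM2l // (le_trans (ND _ _)) // lerD2l.
    by rewrite uinormZ ?(ltW e0) // ler_piMl ?uinorm_ge0.
  have adjXe : (X + e%:M) ^t* = X ^t* + e%:M.
    by rewrite adjmxD -scalemx1 adjmxZ adjmx1 eC.
  have E1 : (X + e%:M) *m (X + e%:M) ^t* = X *m X ^t* + D.
    rewrite adjXe mulmxDl !mulmxDr mul_mx_scalar !mul_scalar_mx /D !scalerDr.
    by rewrite scalemx1 -addrA; congr (_ + _); rewrite addrA.
  have E2 : (X + e%:M) ^t* *m (X + e%:M) = X ^t* *m X + D.
    rewrite adjXe mulmxDl !mulmxDr mul_mx_scalar !mul_scalar_mx /D !scalerDr.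
    rewrite scalemx1 -addrA; congr (_ + _).
    by rewrite addrA [e *: X + _]addrC.
  have -> : X *m X ^t* = (X + e%:M) *m (X + e%:M) ^t* + (- 1) *: D.
    by rewrite E1 scaleN1r addrK.
  rewrite (le_trans (ND _ _)) // NZ normrN1 mul1r uinorm_gramC_unit // E2.
  by rewrite mulr2n addrA lerD // (le_trans (ND _ _)) // lerD2l.
(* If the inequality failed by [t > 0], any [e] with [e <= 1] and
   [2 e M < t] would contradict [near]; [t / (2 M + t + 1)] is below both
   bounds. *)
rewrite real_leNgt ?ger0_real ?uinorm_ge0 //; apply/negP => lt.
move: lt; rewrite -subr_gt0; set t := _ - _ => t0.
have den0 : 0 < M *+ 2 + t + 1.
  by rewrite ltr_wpDl ?ltr01 // addr_ge0 ?mulrn_wge0 ?(ltW t0).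
have [e /andP[e0 ele] Xeu] := exists_small_unit X (divr_gt0 t0 den0).
have e1 : e <= 1.
  apply: le_trans ele _; rewrite ler_pdivrMr // mul1r -addrA addrCA lerDl.
  by rewrite addr_ge0 ?mulrn_wge0.
have := near e; rewrite e0 e1 => /(_ isT Xeu); rewrite -lerBlDl -/t.
have eM_real : e * M *+ 2 \is Num.real.
  by rewrite ger0_real // mulrn_wge0 // mulr_ge0 ?(ltW e0).
apply/negP; rewrite -real_ltNge // ?(gtr0_real t0) //.
have : e * (M *+ 2 + t + 1) <= t by rewrite -ler_pdivlMr.
apply: lt_le_trans; rewrite -mulrnAr ltr_pM2l // -addrA ltrDl.
by rewrite addr_gt0.
Qed.

(** * Comparison with the trace *)

(** Both are Gram matrices of the one matrix unit [delta_mx i j]. *)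
Lemma uinorm_unit_diag (i j : 'I_n) : N (delta_mx i i) = N (delta_mx j j).
Proof.
wlog suff le : i j / N (delta_mx i i) <= N (delta_mx j j).
  by apply/eqP; rewrite eq_le !le.
have := uinorm_gramC (delta_mx i j).
have -> : (delta_mx i j) ^t* = delta_mx j i :> 'M[C]_n.
  by rewrite trmx_delta map_delta_mx.
by rewrite !mul_delta_mx.
Qed.

(** The spectral decomposition writes [A] as a combination of orthogonal
    projections of rank one, all of the same norm. *)
Lemma uinorm_psd_trace i0 (A : 'M[C]_n) : psdmx A ->
  N A <= \tr A * N (delta_mx i0 i0).
Proof.
move=> Apsd; rewrite (psdmx_trace_spectral Apsd) uinorm_spectral //.
rewrite diag_mx_sum_delta (le_trans (uinorm_sum _ _)) //.
rewrite mulr_suml; apply: ler_sum => i _.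
by rewrite uinormZ ?psdmx_spectral_ge0 // (uinorm_unit_diag i i0).
Qed.

(** [A] dominates each term of its spectral decomposition, so each of its
    [n] eigenvalues times the norm of a matrix unit is at most the norm of
    [A]. *)
Lemma trace_psd_uinorm i0 (A : 'M[C]_n) : psdmx A ->
  \tr A * N (delta_mx i0 i0) <= n%:R * N A.
Proof.
move=> Apsd; rewrite (psdmx_trace_spectral Apsd) mulr_suml.
rewrite -[n in n%:R]card_ord -sum1_card natr_sum mulr_suml.
apply: ler_sum => i _; rewrite mul1r -(uinorm_unit_diag i i0).
have d0 := psdmx_spectral_ge0 i Apsd.
rewrite -uinormZ // (uinorm_spectral Apsd).
have -> : spectral_diag A 0 i *: delta_mx i i =
          diag_mx (\row_j (spectral_diag A 0 j *+ (j == i))).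
  apply/matrixP=> j k; rewrite !mxE; case: (eqVneq j i) => [->|_] /=.
    by rewrite eq_sym mulr_natr.
  by rewrite mulr0 mul0rn.
apply: uinorm_diag_le => j; rewrite mxE.
have dj := psdmx_spectral_ge0 j Apsd.
by case: eqP => _ /=; rewrite ?mulr1n ?mulr0n lexx dj.
Qed.

(** * The modulus of a sum *)

(** With [Y = K sqrt(q)], the matrix [K q K^H] is [Y Y^H], whose norm and trace
    are those of [Y^H Y]; and [Y^H Y = sqrt(q) K^H K sqrt(q)] is at most [q],
    which is what is shown here. *)
Lemma psdmx_contraction (q K : 'M[C]_n) : psdmx q -> contraction K ->
  psdmx (q - (K *m sqrtmx q) ^t* *m (K *m sqrtmx q)).
Proof.
move=> qpsd cK; have [Rh _] := sqrtmx_psd qpsd; have RR := sqrtmxK qpsd.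
have := psdmx_conj (sqrtmx q) cK.
by rewrite mulmxBr mulmx1 mulmxBl Rh RR trCmxM Rh !mulmxA.
Qed.

Lemma conj_sqrtmx (q K : 'M[C]_n) : psdmx q ->
  K *m q *m K ^t* = (K *m sqrtmx q) *m (K *m sqrtmx q) ^t*.
Proof.
move=> qpsd; have [Rh _] := sqrtmx_psd qpsd.
by rewrite -[in LHS](sqrtmxK qpsd) trCmxM Rh !mulmxA.
Qed.

Lemma uinorm_conj_le (q K : 'M[C]_n) : psdmx q -> contraction K ->
  N (K *m q *m K ^t*) <= N q.
Proof.
move=> qpsd cK; rewrite conj_sqrtmx // (le_trans (uinorm_gramC _)) //.
apply: uinorm_psd_le; [exact: psdmx_gramr | exact: psdmx_contraction].
Qed.

Lemma trace_conj_le (q K : 'M[C]_n) : psdmx q -> contraction K ->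
  \tr (K *m q *m K ^t*) <= \tr q.
Proof.
move=> qpsd cK; rewrite conj_sqrtmx // mxtrace_mulC.
exact/psdmx_trace_le/psdmx_contraction.
Qed.

(** The bound by [m] comes from the triangle inequality, the bound by [n]
    from the traces. *)
Lemma uinorm_sum_conj_le m (q K : 'I_m -> 'M[C]_n) : (0 < n)%N ->
  (forall k, psdmx (q k)) -> (forall k, contraction (K k)) ->
  N (\sum_k K k *m q k *m (K k) ^t*) <= (minn m n)%:R * N (\sum_k q k).
Proof.
move=> n0 qpsd cK; have Ppsd k : psdmx (K k *m q k *m (K k) ^t*).
  by rewrite -[X in X *m _ *m _]trCmxK; apply: psdmx_conj.
have [_|_] := leqP m n.
  rewrite (le_trans (uinorm_sum _ _)) //.
  rewrite -[m in m%:R]card_ord -sum1_card natr_sum mulr_suml.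
  apply: ler_sum => k _; rewrite mul1r (le_trans (uinorm_conj_le _ _)) //.
  apply: uinorm_psd_le => //; rewrite (bigD1 k) //= addrAC subrr add0r.
  exact: psdmx_sum.
pose i0 := Ordinal n0.
apply: le_trans (trace_psd_uinorm i0 (psdmx_sum _ _ qpsd)).
apply: le_trans (uinorm_psd_trace i0 (psdmx_sum _ _ Ppsd)) _.
rewrite ler_wpM2r ?uinorm_ge0 // !linear_sum /=.
by apply: ler_sum => k _; apply: trace_conj_le.
Qed.

(** A substitute for the Cauchy-Schwarz inequality: expanding
    [\sum_k (K_k - c) q_k (K_k - c)^H >= 0] leaves
    [2 c] times the Hermitian matrix [\sum_k K_k q_k] as cross term, which is
    thus dominated by the sum of the two square terms. *)
Lemma uinorm_psd_sumM_le c m (q K : 'I_m -> 'M[C]_n) : 0 < c ->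
  (forall k, psdmx (q k)) -> psdmx (\sum_k K k *m q k) ->
  N (\sum_k K k *m q k *m (K k) ^t*) <= c ^+ 2 * N (\sum_k q k) ->
  N (\sum_k K k *m q k) <= c * N (\sum_k q k).
Proof.
set L := \sum_k K k *m q k; set P := \sum_k _ *m _ *m _; set S := \sum_k q k.
move=> c0 qpsd Lpsd NP.
have cC : c^* = c by apply/CrealP/gtr0_real.
have square : psdmx (P + c ^+ 2 *: S - (c *+ 2) *: L).
  have LE : L = \sum_k q k *m (K k) ^t*.
    rewrite -[L]Lpsd.1 adjmx_sum; apply: eq_bigr => k _.
    by rewrite trCmxM (qpsd k).1.
  have -> : P + c ^+ 2 *: S - (c *+ 2) *: L =
      \sum_k (K k - c%:M) *m q k *m (K k - c%:M) ^t*.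
    rewrite -scalerMnl mulr2n opprD {2}LE !scaler_sumr -!sumrN -!big_split /=.
    apply: eq_bigr => k _.
    rewrite adjmxB -scalemx1 adjmxZ adjmx1 cC scalemx1.
    rewrite mulmxBl mul_scalar_mx mulmxBr mul_mx_scalar mulmxBl -scalemxAl.
    rewrite scalerBr scalerA -expr2 opprB -!addrA.
    by congr (_ + _); rewrite addrA addrC.
  apply: psdmx_sum => k; rewrite -[X in X *m _ *m _]trCmxK; exact: psdmx_conj.
have c20 : 0 < c *+ 2 by rewrite pmulrn_lgt0.
have := uinorm_psd_le (psdmxZ (ltW c20) Lpsd) square.
rewrite uinormZ ?(ltW c20) // => /le_trans le2.
rewrite -(ler_pM2l c20) (le2 _ (le_trans (ND _ _) _)) //.
rewrite uinormZ ?exprn_ge0 ?(ltW c0) // mulrnAl mulrA -expr2 mulr2n.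
by rewrite lerD2r.
Qed.

(** Multiplying [\sum_k T_k] by the adjoint of its own polar factor turns the
    modulus into a sum of products of square contractions with the moduli of
    the [T_k], so that the constant involves the number of columns only. *)
Theorem uinorm_modulus_sum_le p m (T : 'I_m -> 'M[C]_(p, n)) :
  (0 < m)%N -> (0 < n)%N ->
  N (sqrtmx ((\sum_k T k) ^t* *m \sum_k T k)) <=
    sqrtC (minn m n)%:R * N (\sum_k sqrtmx ((T k) ^t* *m T k)).
Proof.
move=> m0 n0; have [V [_ VT VVV]] := polar_decomposition (\sum_k T k).
pose q k := sqrtmx ((T k) ^t* *m T k).
have qpsd k : psdmx (q k) by apply/sqrtmx_psd/psdmx_gramr.
have [K /all_and2[cK KE]] : exists K : 'I_m -> 'M[C]_n,
    forall k, contraction (K k) /\ V ^t* *m T k = K k *m q k.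
  apply: (@fin_all_exists _ (fun=> _)
    (fun k M => contraction M /\ _ = M *m _)) => k.
  have [U [UE _ UUU]] := polar_decomposition (T k).
  exists (V ^t* *m U); split; last by rewrite -mulmxA UE.
  apply: contractionM; apply: partial_isometry_contraction => //.
  by rewrite trCmxK -[in RHS]VVV !trCmxM trCmxK mulmxA.
have LE : sqrtmx ((\sum_k T k) ^t* *m \sum_k T k) = \sum_k K k *m q k.
  by rewrite -VT mulmx_sumr; apply: eq_bigr.
have Lpsd : psdmx (\sum_k K k *m q k).
  by rewrite -LE; apply/sqrtmx_psd/psdmx_gramr.
rewrite LE; apply: uinorm_psd_sumM_le => //.
  by rewrite sqrtC_gt0 ltr0n leq_min m0.
by rewrite sqrtCK; apply: uinorm_sum_conj_le.
Qed.

End UnitarilyInvariantSeminorm.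

(** * The quadratic symmetric modulus *)

(** The scaling makes the ordinary modulus of this 2n x n matrix equal to the
    quadratic symmetric modulus of [Z]. *)
Definition qsym_stack (C : numClosedFieldType) n (Z : 'M[C]_n) :
    'M[C]_(n + n, n) :=
  sqrtC 2^-1 *: col_mx Z (Z ^t*).

Lemma qsym_modulus (C : numClosedFieldType) n (Z : 'M[C]_n) :
  qsym Z = sqrtmx ((qsym_stack Z) ^t* *m qsym_stack Z).
Proof.
rewrite /qsym /absmx !sqrtmxK; [|exact: psdmx_gram..].
congr sqrtmx; rewrite adjmxZ -scalemxAl -scalemxAr scalerA.
have -> : (sqrtC 2^-1)^* * sqrtC 2^-1 = 2^-1 :> C.
  rewrite (CrealP _) -?expr2 ?sqrtCK //.
  by rewrite ger0_real // sqrtC_ge0 invr_ge0 ler0n.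
by rewrite tr_col_mx map_row_mx mul_row_col trCmxK.
Qed.

Lemma qsym_stack_sum (C : numClosedFieldType) n m (A : 'I_m -> 'M[C]_n) :
  qsym_stack (\sum_k A k) = \sum_k qsym_stack (A k).
Proof.
apply: (big_morph (@qsym_stack C n)) => [Y Z|].
  by rewrite /qsym_stack adjmxD -add_col_mx scalerDr.
by rewrite /qsym_stack trmx0 map_mx0 col_mx0 scaler0.
Qed.

Theorem theorem1p13 (R : realType) (m n : nat) (hm : (2 <= m)%N)
    (hn : (2 <= n)%N) (N : 'M[R[i]]_n -> R) (hN : is_norm N)
    (hU : unitarily_invariant N) (A : 'I_m -> 'M[R[i]]_n) :
  N (qsym (\sum_k A k)) <=
    Num.sqrt (minn m (2 * n))%:R * N (\sum_k qsym (A k)).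
Proof.
case: hN => _ NZ ND; pose NC Z : R[i] := (N Z)%:C%C.
have NCZ a Z : NC (a *: Z) = `|a| * NC Z := NZ a Z.
have NCD Y Z : NC (Y + Z) <= NC Y + NC Z by rewrite /NC -rmorphD lecR.
have NCU Z U V : U \is unitarymx -> V \is unitarymx -> NC (U *m Z *m V) = NC Z.
  by move=> UU VU; rewrite /NC hU.
have sqrtE k : sqrtC (k%:R : R[i]) = (Num.sqrt (k%:R : R))%:C%C.
  have -> : k%:R = (Num.sqrt (k%:R : R))%:C%C ^+ 2.
    by rewrite -rmorphXn sqr_sqrtr ?ler0n // rmorph_nat.
  by rewrite sqrCK // lecR sqrtr_ge0.
have /= := uinorm_modulus_sum_le NCZ NCD NCU (fun k => qsym_stack (A k))
  (ltnW hm) (ltnW hn).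
rewrite -qsym_stack_sum -qsym_modulus.
under eq_bigr do rewrite -qsym_modulus.
rewrite sqrtE /NC -rmorphM lecR => /le_trans; apply.
have N0 Z : 0 <= N Z by have := uinorm_ge0 NCZ NCD Z; rewrite lecR.
rewrite ler_wpM2r // ler_sqrt ?ler0n // ler_nat leq_min geq_minl.
by rewrite geq_min mul2n -addnn leq_addr orbT.
Qed.
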